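(* Every positive integer can be written uniquely as a sum $a_{\ell_1}+\cdots+a_{\ell_k}$ of distinct terms $\ell_1<\cdots<\ell_k$ of the Kentucky-2 sequence $(a_n)$ such that no two summands are in the same bin and no two summands belong to consecutive bins.
   Context: The Kentucky-2 sequence $(a_n)_{n\ge1}$ is defined as follows. The index $\ell$ (and the term $a_\ell$) belongs to bin number $\lceil \ell/2\rceil$, so the $k$-th bin is $b_k=\{a_{2k-1},a_{2k}\}$. A legal decomposition of an integer $m\ge0$ using terms from $\{a_1,\dots,a_N\}$ is an expression $m=a_{\ell_1}+\cdots+a_{\ell_k}$ with $k\ge0$ and $1\le\ell_1<\cdots<\ell_k\le N$ such that $\lceil \ell_{j+1}/2\rceil-\lceil \ell_j/2\rceil\ge2$ for all $j$ (no two summands in the same or in consecutive bins). The sequence is built greedily: $a_1=1$, and for $N\ge1$, $a_{N+1}$ is the smallest positive integer having no legal decomposition using terms from $\{a_1,\dots,a_N\}$. (Its first terms are $1,2,3,4,5,8,11,16,\dots$.) *)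

(* Defs.v *)
From mathcomp Require Import all_boot.

Set Implicit Arguments.
Unset Strict Implicit.
Unset Printing Implicit Defensive.

(* Indices start at 1; [uphalf l] is the ceiling of [l / 2]. *)
Definition bin (l : nat) : nat := uphalf l.

(* [s] lists the indices l_1 < ... < l_k of the summands. *)
Definition legal (s : seq nat) : bool :=
  [&& all (fun l => 1 <= l) s,
      sorted ltn s
    & sorted (fun i j => bin i + 2 <= bin j) s].

Definition legal_decomposition (a : nat -> nat) (m : nat) (s : seq nat) : Prop :=
  legal s /\ m = \sum_(l <- s) a l.

Definition has_legal_decomposition (a : nat -> nat) (N m : nat) : Prop :=
  exists s : seq nat, legal_decomposition a m s /\ all (fun l => l <= N) s.

Definition least (P : nat -> Prop) (n : nat) : Prop :=
  P n /\ forall m, P m -> n <= m.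

(* The value [a 0] is irrelevant. *)
Definition is_kentucky2 (a : nat -> nat) : Prop :=
  a 1 = 1 /\
  forall N, 1 <= N ->
    least (fun m => 0 < m /\ ~ has_legal_decomposition a N m) (a N.+1).

(* [legal] compares neighbouring summands only; this is the same as excluding
   every pair of summands in the same bin or in consecutive bins. *)
Lemma legal_pairwise (s : seq nat) :
  legal s =
  [&& all (fun l => 1 <= l) s, sorted ltn s
    & pairwise (fun i j => (bin i != bin j) && ((bin i).+1 != bin j)) s].
Proof.
rewrite /legal; case: (all _ s) => //=.
case ss: (sorted ltn s) => //=.
rewrite sorted_pairwise; last first.
  by move=> y x z h1 h2; apply: leq_trans h1 (leq_trans (leq_addr _ _) h2).
move: ss; rewrite (sorted_pairwise ltn_trans).
elim: s => //= x s IH /andP[xs ss]; rewrite IH //; congr andb.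
apply: eq_in_all => y ys.
have: bin x <= bin y by apply: uphalf_leq; apply/ltnW/(allP xs).
by rewrite addn2 [_ < bin y]ltn_neqAle [bin x < bin y]ltn_neqAle => ->; rewrite andbT andbC.
Qed.

Definition has_legal_decompositionb (a : nat -> nat) (N m : nat) : bool :=
  [exists t : N.-tuple bool,
     legal (mask t (iota 1 N)) && (m == \sum_(l <- mask t (iota 1 N)) a l)].

Lemma has_legal_decompositionP a N m : reflect (has_legal_decomposition a N m) (has_legal_decompositionb a N m).
Proof.
apply: (iffP existsP) => [[t /andP[lt /eqP mE]]|[s [[ls mE] sN]]].
  exists (mask t (iota 1 N)); split=> //; apply/allP => l /mem_mask.
  by rewrite mem_iota add1n ltnS => /andP[].
have sE : s = mask (map (mem s) (iota 1 N)) (iota 1 N).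
  rewrite -filter_mask; case/and3P: ls => s1 ss _.
  apply: (irr_sorted_eq ltn_trans ltnn ss).
    by apply: (sorted_filter ltn_trans); apply: iota_ltn_sorted.
  move=> l; rewrite mem_filter mem_iota add1n ltnS /=.
  by case: (boolP (l \in s)) => // h; rewrite (allP s1 _ h) (allP sN _ h).
have st : size (map (mem s) (iota 1 N)) == N by rewrite size_map size_iota.
by exists (Tuple st); rewrite /= -sE ls mE eqxx.
Qed.

Lemma kentucky2_next_ex a N : exists m, (0 < m) && ~~ has_legal_decompositionb a N m.
Proof.
pose F (t : N.-tuple bool) := \sum_(l <- mask t (iota 1 N)) a l.
exists (\max_t F t).+1; apply/existsP => -[t /andP[_ /eqP E]].
by have := @leq_bigmax _ F t; rewrite /F -E ltnn.
Qed.

Fixpoint kentucky2_prefix (N : nat) : seq nat :=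
  if N is N'.+1 then rcons (kentucky2_prefix N') (ex_minn (kentucky2_next_ex (nth 0 (kentucky2_prefix N')) N'))
  else [:: 0].

Definition kentucky2 (n : nat) : nat := nth 0 (kentucky2_prefix n) n.

Lemma size_prefix N : size (kentucky2_prefix N) = N.+1.
Proof. by elim: N => //= N IH; rewrite size_rcons IH. Qed.

Lemma nth_prefix N l : l <= N -> nth 0 (kentucky2_prefix N) l = kentucky2 l.
Proof.
elim: N => [|N IH]; first by case: l.
rewrite leq_eqVlt => /orP[/eqP-> //|lN] /=.
by rewrite nth_rcons size_prefix lN IH.
Qed.

Lemma eq_has a b N m : (forall l, l <= N -> a l = b l) ->
  has_legal_decomposition a N m -> has_legal_decomposition b N m.
Proof.
move=> ab [s [[ls ->] sN]]; exists s; split=> //; split=> //.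
by apply: eq_big_seq => l /(allP sN); apply: ab.
Qed.

Lemma kentucky2_least N :
  least (fun m => 0 < m /\ ~ has_legal_decomposition kentucky2 N m)
        (kentucky2 N.+1).
Proof.
rewrite {2}/kentucky2 /= nth_rcons size_prefix ltnn eqxx.
case: ex_minnP => m /andP[m0 /has_legal_decompositionP nm] min_m; split.
  by split=> // h; apply/nm/(eq_has _ h) => l /nth_prefix.
move=> k [k0 nk]; apply: min_m; rewrite k0; apply/has_legal_decompositionP => h.
by apply/nk/(eq_has _ h) => l /nth_prefix.
Qed.

Lemma kentucky2P : is_kentucky2 kentucky2.
Proof.
split=> [|N _]; last exact: kentucky2_least.
have [[k0 _] min_k] := kentucky2_least 0.
apply/eqP; rewrite eqn_leq k0 andbT; apply: min_k; split=> // -[s [[ls E] s0]].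
case: s ls E s0 => [|l s]; first by rewrite big_nil.
by case/andP=> /= /andP[l1 _] _ _ /andP[l0 _]; rewrite leqNgt l1 in l0.
Qed.

Lemma is_kentucky2_unique a b :
  is_kentucky2 a -> is_kentucky2 b -> forall n, 1 <= n -> a n = b n.
Proof.
move=> [a1 aP] [b1 bP].
have H : forall N n, 1 <= n <= N -> a n = b n.
  elim=> [|N IH] n /andP[n1 nN]; first by case: n n1 nN.
  move: nN; rewrite leq_eqVlt => /orP[/eqP nE|nN]; last by rewrite IH ?n1.
  rewrite {}nE in n1 *; case: N IH n1 => [|N] IH _; first by rewrite a1 b1.
  have hab m : has_legal_decomposition a N.+1 m <->
               has_legal_decomposition b N.+1 m.
    split=> -[s [[ls ->] sN]]; exists s; split=> //; split=> //;
      apply: eq_big_seq => l ls'; case/and3P: ls => s1 _ _;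
      by rewrite IH // (allP s1 _ ls') (allP sN _ ls').
  have [[a0 na] mina] := aP N.+1 isT; have [[b0 nb] minb] := bP N.+1 isT.
  apply/eqP; rewrite eqn_leq; apply/andP; split.
    by apply: mina; split=> // /hab.
  by apply: minb; split=> // /hab.
by move=> n n1; apply: (H n); rewrite n1 leqnn.
Qed.

(* Main.v *)
(** Let [gap N] be the largest index whose bin lies at least two before the bin
    of [N.+1]. A legal index list with entries at most [N.+1] either has entries
    at most [N], or is a list with entries at most [gap N] followed by [N.+1].
    By strong induction the lists with entries at most [N] represent each element
    of the interval [[0, a N.+1)] exactly once: the lists ending in [N.+1] cover
    the adjacent interval of length [a (gap N).+1], and greediness then forces
    [a N.+2 = a N.+1 + a (gap N).+1]. No closed form for [a] is needed. *)
Require Import Defs.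
From mathcomp Require Import all_boot.

Set Implicit Arguments.
Unset Strict Implicit.
Unset Printing Implicit Defensive.

Definition legal_upto (N : nat) (s : seq nat) : bool :=
  legal s && all (fun l => l <= N) s.

(** Bin [b] ends at index [b.*2]. Truncated subtraction yields [0] when [N.+1] lies in the first two
    bins, so that only the empty list may precede it. *)
Definition gap (N : nat) : nat := (bin N.+1 - 2).*2.

Lemma gap_le N : gap N <= N.
Proof. by rewrite /gap /bin -geq_half_double uphalfE /= subSS leq_subr. Qed.

(** Positivity of [l] matters: for [l = 0] and [N = 0] the left side is false and the right side
    true. *)
Lemma bin_le_gap N l : 0 < l -> (bin l + 2 <= bin N.+1) = (l <= gap N).
Proof.
case: l => // l _; rewrite /gap -leq_uphalf_double -/(bin _).
by case: (bin N.+1) => [|[|b]]; rewrite addn2 // subn2.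
Qed.

(** Both neighbour relations are transitive, so sortedness is a pairwise condition and the last
    index constrains every earlier one, not just its neighbour. *)
Lemma legal_rcons s N : legal (rcons s N.+1) = legal_upto (gap N) s.
Proof.
have trb : transitive (fun i j => bin i + 2 <= bin j).
  by move=> y x z h1 h2; apply: leq_trans h1 (leq_trans (leq_addr _ _) h2).
rewrite /legal_upto /legal all_rcons !(sorted_pairwise ltn_trans).
rewrite !(sorted_pairwise trb) !pairwise_rcons /=.
case s1: (all _ s) => //=.
rewrite (@eq_in_all _ (fun l => bin l + 2 <= bin N.+1) (fun l => l <= gap N));
  last by move=> l /(allP s1); apply: bin_le_gap.
case sg: (all (fun l => l <= gap N) s); last by rewrite !andbF.
rewrite andbT /=; congr (_ && _).
suff -> : all (ltn^~ N.+1) s by [].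
by apply: sub_all sg => l lg; rewrite /= ltnS (leq_trans lg) // gap_le.
Qed.

Lemma legal_upto_leq M N s : M <= N -> legal_upto M s -> legal_upto N s.
Proof.
move=> MN /andP[ls sM]; rewrite /legal_upto ls.
by apply: sub_all sM => l lM; apply: leq_trans MN.
Qed.

Lemma legal_upto_rcons N s :
  legal_upto (gap N) s -> legal_upto N.+1 (rcons s N.+1).
Proof.
move=> ls; rewrite /legal_upto legal_rcons ls all_rcons leqnn.
by case/andP: (legal_upto_leq (leqW (gap_le N)) ls).
Qed.

Lemma legal_uptoS N s : legal_upto N.+1 s ->
  legal_upto N s \/ exists2 t, legal_upto (gap N) t & s = rcons t N.+1.
Proof.
case/lastP: s => [|s x] /andP[ls]; first by left.
rewrite all_rcons => /andP[xN _].
case: x ls xN => [|x] ls; first by move: ls; rewrite /legal all_rcons.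
rewrite leq_eqVlt ltnS => /orP[/eqP[xE]|xN].
  by right; exists s; rewrite ?xE // -legal_rcons -xE.
(* The last index [x.+1] bounds the whole list, and [x.+1 <= N]. *)
by left; apply: (legal_upto_leq xN); apply: legal_upto_rcons; rewrite -legal_rcons.
Qed.

Section Kentucky2.

Variables (a : nat -> nat) (ha : is_kentucky2 a).

Let value (s : seq nat) : nat := \sum_(l <- s) a l.

Lemma has_legal_decomposition_upto N m :
  has_legal_decomposition a N m <-> exists2 s, legal_upto N s & m = value s.
Proof.
split=> [[s [[ls mE] sN]]|[s /andP[ls sN] mE]]; exists s => //.
by rewrite /legal_upto ls.
Qed.

Lemma kentucky2_gt0 N : 0 < a N.+1.
Proof.
by case: ha => a1 aP; case: N => [|N]; [rewrite a1|case: (aP N.+1 isT) => -[]].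
Qed.

Definition bijective_upto (N : nat) : Prop :=
  [/\ forall s, legal_upto N s -> value s < a N.+1,
      forall m, m < a N.+1 -> exists2 s, legal_upto N s & m = value s
    & forall s t, legal_upto N s -> legal_upto N t -> value s = value t -> s = t].

(** Minimality gives [a N.+2 <= x], as [x] itself is not represented; [a N.+2 < x] would make
    [a N.+2] representable. *)
Lemma kentucky2_next N x : 0 < x ->
  (forall m, m < x <-> exists2 s, legal_upto N.+1 s & m = value s) ->
  a N.+2 = x.
Proof.
move=> x0 xP; case: ha => _ /(_ N.+1 isT)[[_ na] mina].
apply/eqP; rewrite eqn_leq; apply/andP; split.
  by apply: mina; split=> // /has_legal_decomposition_upto/xP; rewrite ltnn.
by rewrite leqNgt; apply/negP => /xP/has_legal_decomposition_upto.
Qed.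

Lemma value_rcons s l : value (rcons s l) = a l + value s.
Proof. by rewrite /value big_rcons addnC. Qed.

Lemma bijective_uptoS N : bijective_upto N -> bijective_upto (gap N) ->
  a N.+2 = a N.+1 + a (gap N).+1 /\ bijective_upto N.+1.
Proof.
move=> [ltN exN injN] [ltG exG injG].
have ltS s : legal_upto N.+1 s -> value s < a N.+1 + a (gap N).+1.
  case/legal_uptoS=> [/ltN lts|[t /ltG ltt ->]]; first exact: ltn_addr.
  by rewrite value_rcons ltn_add2l.
have exS m : m < a N.+1 + a (gap N).+1 ->
    exists2 s, legal_upto N.+1 s & m = value s.
  case: (ltnP m (a N.+1)) => [/exN[s ls ->] _|le_m].
    by exists s => //; apply: legal_upto_leq ls.
  rewrite -ltn_subLR // => /exG[s ls mE]; exists (rcons s N.+1).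
    exact: legal_upto_rcons.
  by rewrite value_rcons -mE subnKC.
have aE : a N.+2 = a N.+1 + a (gap N).+1.
  apply: kentucky2_next => [|m]; first by rewrite addn_gt0 kentucky2_gt0.
  by split=> [|[s ls ->]]; [apply: exS|apply: ltS].
split=> //; split; rewrite ?aE // => s t.
(* The mixed cases are impossible: a list ending in [N.+1] has value at least [a N.+1], a list with
   entries at most [N] a smaller one. *)
case/legal_uptoS=> [ls|[s' ls ->]] /legal_uptoS[lt|[t' lt ->]].
- exact: injN.
- by move=> E; have := ltN _ ls; rewrite E value_rcons ltnNge leq_addr.
- by move=> E; have := ltN _ lt; rewrite -E value_rcons ltnNge leq_addr.
- by rewrite !value_rcons => /addnI/(injG _ _ ls lt) ->.
Qed.

Lemma kentucky2_bijective_upto N : bijective_upto N.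
Proof.
elim/ltn_ind: N => -[_|N IH].
  have upto0 s : legal_upto 0 s -> s = [::].
    by case: s => // l s /andP[/and3P[/andP[l1 _] _ _] /andP[]]; rewrite leqNgt l1.
  case: ha => a1 _; split; rewrite ?a1.
  - by move=> s /upto0 ->; rewrite /value big_nil.
  - by case=> // _; exists [::]; rewrite // /value big_nil.
  - by move=> s t /upto0 -> /upto0 ->.
by case: (@bijective_uptoS N) => //; apply: IH; rewrite // ltnS gap_le.
Qed.

(** Makes [m] itself a sufficient index bound for decomposing [m]; the recurrence adds at least 1 at
    each step. *)
Lemma ltn_kentucky2 N : N < a N.+1.
Proof.
elim: N => [|N IH]; first exact: kentucky2_gt0.
have [||-> _] := @bijective_uptoS N; try exact: kentucky2_bijective_upto.
by rewrite -[N.+2]addn1 leq_add // kentucky2_gt0.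
Qed.

End Kentucky2.

Theorem theorem1p2 (a : nat -> nat) (ha : is_kentucky2 a) (m : nat) (hm : 0 < m) :
  exists! s : seq nat, legal_decomposition a m s.
Proof.
have [_ /(_ m (ltn_kentucky2 ha m)) [s ls mE] _] := kentucky2_bijective_upto ha m.
exists s; split=> [|t [lt mE']]; first by case/andP: ls.
(* The competitor [t] has no a priori index bound, so injectivity is applied at a bound common to
   [s] and [t]. *)
pose N := maxn m (\max_(l <- t) l).
have [_ _ inj] := kentucky2_bijective_upto ha N.
apply: inj; last by rewrite -mE.
  exact: legal_upto_leq (leq_maxl _ _) ls.
rewrite /legal_upto lt; apply/allP => l lt'.
by rewrite leq_max (leq_bigmax_seq _ lt') ?orbT.
Qed.
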